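(* There exists a constant $C>0$ such that for any $\mathbf{u}\in\mathbf{V}$, $$\|\mathbf{u}\|_{L^2(\Omega)}\le C\|\partial_y\mathbf{u}\|_{L^2(\Omega)}.$$
   Context: $\Omega:=\mathbb{R}\times(0,1)\subset\mathbb{R}^2$ with points $(x,y)$, and $\mathbf{n}$ is the unit outer normal on $\partial\Omega$. $\mathbf{V}:=\{\mathbf{v}\in H^1(\Omega)^2:\nabla\cdot\mathbf{v}=0,\ \mathbf{v}\cdot\mathbf{n}=0\text{ on }\partial\Omega\}$. *)

(* Defs.v *)
From HB Require Import structures.
From mathcomp Require Import all_boot all_order all_algebra.
From mathcomp Require Import all_classical all_reals all_analysis.

Set Implicit Arguments.
Unset Strict Implicit.
Unset Printing Implicit Defensive.

Import Order.TTheory GRing.Theory Num.Theory.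
Import numFieldNormedType.Exports.

Local Open Scope classical_set_scope.
Local Open Scope ring_scope.

Definition plane_measure (R : realType) :
    {measure set (measurableTypeR R * measurableTypeR R) -> \bar R} :=
  (@lebesgue_measure R \x @lebesgue_measure R)%E.

Definition strip (R : realType) : set (R * R) := [set z | 0 < z.2 < 1].

Arguments strip R : clear implicits.

Definition ex (R : realType) : R * R := (1, 0).
Definition ey (R : realType) : R * R := (0, 1).

Section L2.
Context (R : realType) (d : measure_display) (T : measurableType d).
Variables (mu : {measure set T -> \bar R}) (D : set T).

Definition L2norm (f : T -> R) : \bar R := 'N[mu]_2%:E[EFin \o (f \_ D)].

Definition in_L2 (f : T -> R) : Prop :=
  measurable_fun D f /\ (L2norm f < +oo)%E.

End L2.

Section Sobolev.
Context (R : realType).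
Implicit Types (f phi u w g : R * R -> R) (e : R * R).

Definition iter_partial (s : seq (R * R)) f : R * R -> R :=
  foldr (fun e h => 'D_e h) f s.

Definition smooth f : Prop :=
  forall s : seq (R * R), {subset s <= [:: ex R; ey R]} ->
    continuous (iter_partial s f) /\
    forall z e, e \in [:: ex R; ey R] -> derivable (iter_partial s f) z e.

Definition test_function (D : set (R * R)) phi : Prop :=
  smooth phi /\
  exists K : set (R * R),
    [/\ compact K, K `<=` D & forall z, ~ K z -> phi z = 0].

Definition strip_L2norm f : \bar R := L2norm (plane_measure R) (strip R) f.

Definition in_strip_L2 f : Prop := in_L2 (plane_measure R) (strip R) f.

Definition is_weak_partial e u w : Prop :=
  forall phi, test_function (strip R) phi ->
    (\int[plane_measure R]_(z in strip R) (u z * 'D_e phi z)%:E =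
     - \int[plane_measure R]_(z in strip R) (w z * phi z)%:E)%E.

(* The weak partial derivative is only determined almost everywhere; this
   picks one square-integrable representative (and 0 if there is none). *)
Definition weak_partial e u : R * R -> R :=
  xget (cst 0) [set w | in_strip_L2 w /\ is_weak_partial e u w].

Definition H1 u : Prop :=
  in_strip_L2 u /\
  forall e, e \in [:: ex R; ey R] ->
    exists w, in_strip_L2 w /\ is_weak_partial e u w.

(* The boundary consists of the lines y = 0 and y = 1, each carrying the
   one-dimensional Lebesgue measure as surface measure. Only the values of
   g on these two lines matter. As usual, the trace is the continuous extension
   to H^1 of the restriction to the boundary, starting from the restrictions
   to the strip of smooth compactly supported functions on the plane, which
   are dense in H^1. *)
Definition is_trace u g : Prop :=
  (forall b : R, b \in [:: 0; 1] ->
     in_L2 (@lebesgue_measure R) setT (fun x => g (x, b))) /\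
  exists phi : nat -> R * R -> R,
    [/\ forall k, test_function setT (phi k),
        strip_L2norm (phi k \- u) @[k --> \oo] --> 0%E,
        forall e, e \in [:: ex R; ey R] ->
          strip_L2norm ('D_e (phi k) \- weak_partial e u) @[k --> \oo] --> 0%E
      & forall b : R, b \in [:: 0; 1] ->
          L2norm (@lebesgue_measure R) setT
            (fun x => phi k (x, b) - g (x, b)) @[k --> \oo] --> 0%E].

(* Unit outer normal of the strip, meaningful for z.2 = 0 and z.2 = 1 only. *)
Definition outer_normal (z : R * R) : R * R :=
  (0, if z.2 == 0 then -1 else 1).

Definition normal_trace0 (v : R * R -> R * R) : Prop :=
  exists g1 g2 : R * R -> R,
    [/\ is_trace (fst \o v) g1, is_trace (snd \o v) g2 &
      forall b : R, b \in [:: 0; 1] ->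
        {ae @lebesgue_measure R, forall x,
          g1 (x, b) * (outer_normal (x, b)).1 +
          g2 (x, b) * (outer_normal (x, b)).2 = 0}].

Definition weak_div (v : R * R -> R * R) : R * R -> R :=
  weak_partial (ex R) (fst \o v) \+ weak_partial (ey R) (snd \o v).

Definition in_V (v : R * R -> R * R) : Prop :=
  [/\ H1 (fst \o v) /\ H1 (snd \o v),
      {ae plane_measure R, forall z, strip R z -> weak_div v z = 0} &
      normal_trace0 v].

Definition weak_partial_vec e (v : R * R -> R * R) : R * R -> R * R :=
  fun z => (weak_partial e (fst \o v) z, weak_partial e (snd \o v) z).

Definition strip_L2norm_vec (v : R * R -> R * R) : \bar R :=
  strip_L2norm (fun z => Num.sqrt ((v z).1 ^+ 2 + (v z).2 ^+ 2)).

End Sobolev.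

(* Main.v *)
(* By definition of the trace, [u] comes with test functions [phi k], [psi k] on
   the plane that approximate its two components in H^1 of the strip and whose
   boundary values converge. The boundary values of [psi k] tend to 0 in L^2, so
   integrating [D_y psi k] along vertical segments bounds the second component.
   For the first one the same integration leaves the vertical means
   [M_k x = \int_0^1 phi k (x, y) dy]. As the divergence tends to 0,
   [M_k' = \int_0^1 (D_x phi k + D_y psi k) dy - psi k (x, 1) + psi k (x, 0)]
   tends to 0 in L^2(R). Hence [M_k], being L^2-bounded, tends to 0 uniformly, and
   being L^2-Cauchy with bounded supports it tends to 0 in L^2(R). *)
Require Import Defs.
From mathcomp Require Import all_boot all_order all_algebra.
From mathcomp Require Import all_classical all_reals all_analysis.
From mathcomp Require Import measurable_realfun.
From mathcomp Require Import ring lra.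

Set Implicit Arguments.
Unset Strict Implicit.
Unset Printing Implicit Defensive.

Import Order.TTheory GRing.Theory Num.Theory.
Import numFieldNormedType.Exports.

Local Open Scope classical_set_scope.
Local Open Scope ring_scope.

(** * Squared $L^2$ norms *)

Definition energy {d} {T : measurableType d} {R : realType}
    (mu : {measure set T -> \bar R}) (D : set T) (f : T -> R) : \bar R :=
  (\int[mu]_(x in D) ((f x) ^+ 2)%:E)%E.

Section energy.
Context d (T : measurableType d) (R : realType).
Variables (mu : {measure set T -> \bar R}) (D : set T).
Hypothesis mD : measurable D.
Implicit Types f g h : T -> R.

Lemma energy_ge0 f : (0 <= energy mu D f)%E.
Proof. by apply: integral_ge0 => x _; rewrite lee_fin sqr_ge0. Qed.

Lemma measurable_sqr f : measurable_fun D f ->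
  measurable_fun D (fun x => (f x ^+ 2)%:E : \bar R).
Proof. by move=> mf; apply/measurable_EFinP; exact: measurable_funX. Qed.

Lemma L2norm_energy f : L2norm mu D f = (energy mu D f `^ 2^-1)%E.
Proof.
rewrite /L2norm unlock; congr (_ `^ _)%E.
rewrite /energy [RHS]integral_mkcond; apply: eq_integral => x _ /=.
rewrite !patchE /=; case: ifPn => _.
  by rewrite powR_mulrn// real_normK// num_real.
by rewrite normr0 powR0.
Qed.

Lemma energy_lt_pinfty f : (L2norm mu D f < +oo -> energy mu D f < +oo)%E.
Proof.
rewrite L2norm_energy; case: (energy _ _ _) (energy_ge0 f) => [r||]//= _; rewrite ?ltry//.
by rewrite invr_eq0 pnatr_eq0.
Qed.

(** Replaces Minkowski's inequality: each triangle-type estimate below is a pointwise inequality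
    between squares, integrated by monotonicity and linearity, so that no square root has to be
    handled. *)
Lemma energy_le2 f g h (a b : R) : measurable_fun D f -> measurable_fun D g ->
  measurable_fun D h -> 0 <= a -> 0 <= b ->
  {ae mu, forall x, D x -> f x ^+ 2 <= a * g x ^+ 2 + b * h x ^+ 2} ->
  (energy mu D f <= a%:E * energy mu D g + b%:E * energy mu D h)%E.
Proof.
move=> mf mg mh a0 b0 fgh.
have sq0 k x : D x -> (0 <= ((k x : R) ^+ 2)%:E)%E.
  by rewrite lee_fin sqr_ge0.
have msq := measurable_sqr.
rewrite /energy -!ge0_integralZl_EFin//; try by [exact: msq|move=> x; exact: sq0].
rewrite -ge0_integralD//; last 4 first.
- by move=> x Dx; rewrite mule_ge0// sq0.
- by apply: measurable_funeM; exact: msq.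
- by move=> x Dx; rewrite mule_ge0// sq0.
- by apply: measurable_funeM; exact: msq.
apply: ae_ge0_le_integral => //.
- exact: sq0.
- exact: msq.
- by move=> x Dx; rewrite adde_ge0// mule_ge0// sq0.
- by apply: emeasurable_funD; apply: measurable_funeM; exact: msq.
Qed.

Lemma energy_L2norm f : energy mu D f = (L2norm mu D f * L2norm mu D f)%E.
Proof.
have h : 2^-1 + 2^-1 = 1 :> R by lra.
rewrite L2norm_energy -poweRD ?h ?poweRe1 ?energy_ge0//.
by rewrite /poweRD_def h oner_eq0.
Qed.

Lemma energy_cvg0 (f : nat -> T -> R) :
  L2norm mu D (f k) @[k --> \oo] --> 0%E ->
  energy mu D (f k) @[k --> \oo] --> 0%E.
Proof.
move=> c0; rewrite (_ : (fun k => _) = fun k => (L2norm mu D (f k) * L2norm mu D (f k))%E).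
  by rewrite -[X in _ --> X](mule0 0%E); apply: cvgeM.
by apply/funext => k; exact: energy_L2norm.
Qed.
End energy.

(** * Measurability in the plane *)

Lemma open_plane_measurable (R : realType) (U : set (R * R)) :
  open U -> measurable (U : set (measurableTypeR R * measurableTypeR R)).
Proof.
move=> oU.
(* The plane carries the product sigma-algebra, so [U] is written as a countable union of measurable
   rectangles: the products of balls with rational centres and radius [n.+1%:R^-1] that lie in
   [U]. *)
pose box (q : rat * rat * nat) : set (R * R) :=
  ball (ratr q.1.1 : R) (q.2.+1%:R^-1) `*` ball (ratr q.1.2 : R) (q.2.+1%:R^-1).
have -> : U = \bigcup_q (if `[< box q `<=` U >] then box q else set0).
  apply/seteqP; split=> [[x y] Uxy|z [q _]]; last first.
    by case: asboolP => // /[apply].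
  have [e /= e0 eU] : nbhs_ball (x, y) U by rewrite nbhs_ballE; exact: open_nbhs_nbhs.
  have [n ne] : exists n : nat, n.+1%:R^-1 < e / 2.
    have [n _ /(_ n (leqnn n)) /= ne] :=
      @near_infty_natSinv_lt R (PosNum (divr_gt0 e0 (ltr0n R 2))).
    by exists n.
  have [w [wE w0 we]] : exists w : R, [/\ w = n.+1%:R^-1, 0 < w & w < e / 2].
    by exists n.+1%:R^-1; rewrite invr_gt0 ltr0n.
  have approx t : exists q : rat, ball (ratr q : R) w t.
    have [|q] := @rat_in_itvoo R (t - w) (t + w); first by lra.
    rewrite in_itv/= => /andP[tq qt]; exists q.
    by rewrite /ball/= ltr_norml; apply/andP; split; lra.
  have [[p px] [q qy]] := (approx x, approx y).
  exists (p, q, n) => //.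
  case: asboolP => [_|]; first by rewrite /box/= -wE.
  apply: contra_notP => _; apply: subset_trans eU.
  rewrite /box/= -wE => -[x' y'] [/= px' qy'].
  have split2 : w + w <= e by lra.
  split => /=; apply: le_ball split2 _ _.
    by apply: ball_triangle px'; exact: ball_sym.
  by apply: ball_triangle qy'; exact: ball_sym.
apply: countable_bigcupT_measurable; first exact: countableP.
move=> q; case: asboolP => // _; apply: measurableX; apply: open_measurable; exact: ball_open.
Qed.

Lemma continuous_plane_measurable (R : realType) (f : R * R -> R) :
  continuous f ->
  measurable_fun [set: measurableTypeR R * measurableTypeR R] f.
Proof.
move=> /continuousP cf; apply: (measurability _ (RGenOpens.measurableE R)).
move=> _ [_ [a [b ->] <-]]; rewrite setTI; apply: open_plane_measurable.
exact/cf/interval_open.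
Qed.

Lemma energy_subset d (T : measurableType d) (R : realType)
    (mu : {measure set T -> \bar R}) (A B : set T) (f : T -> R) :
  measurable A -> measurable B -> measurable_fun B f -> A `<=` B ->
  (energy mu A f <= energy mu B f)%E.
Proof.
move=> mA mB mf AB; apply: ge0_subset_integral => //.
- exact: measurable_sqr.
- by move=> x _; rewrite lee_fin sqr_ge0.
Qed.

(** * Integral inequalities on a bounded interval *)

Section line.
Variable R : realType.
Local Notation lambda := (@lebesgue_measure R).
Implicit Types (f g h : R -> R) (a b s t x : R).

Lemma continuous_itv_integrable h a b :
  continuous h -> lambda.-integrable `[a, b] (EFin \o h).
Proof.
move=> ch; apply: continuous_compact_integrable; first exact: segment_compact.
exact: continuous_subspaceT.
Qed.

Lemma continuous_sqr h : continuous h -> continuous (fun x => h x ^+ 2).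
Proof.
move=> ch x; apply: (@continuous_comp _ _ _ h (fun y => y ^+ 2)); first exact: ch.
exact: exprn_continuous.
Qed.

Lemma continuous_energy_itv h a b : continuous h ->
  energy lambda `[a, b] h = (\int[lambda]_(x in `[a, b]) h x ^+ 2)%:E.
Proof.
move=> ch; rewrite /energy /Rintegral fineK//.
apply: integrable_fin_num => //.
exact: (@continuous_itv_integrable (fun x => h x ^+ 2) a b (continuous_sqr ch)).
Qed.

(** Cauchy-Schwarz against the constant 1: with [c] the mean value of [h], expanding
    [(h x - c) ^+ 2] under the integral leaves the nonnegative quantity [J - I ^+ 2 / (b - a)]. The
    mean divides by [b - a], hence the separate case [a = b]. *)
Lemma sqr_Rintegral_le h a b : a <= b -> continuous h ->
  (\int[lambda]_(x in `[a, b]) h x) ^+ 2 <=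
  (b - a) * \int[lambda]_(x in `[a, b]) h x ^+ 2.
Proof.
rewrite le_eqVlt => /predU1P[<-|ab] ch.
  by rewrite set_itv1 !Rintegral_set1 mulr0 expr0n.
set I := \int[_]_(_ in _) h _; set J := \int[_]_(_ in _) _ ^+ 2.
have ih := @continuous_itv_integrable h a b ch.
have ih2 := @continuous_itv_integrable (fun x => h x ^+ 2) a b (continuous_sqr ch).
pose c := I / (b - a).
have ba : 0 < b - a by rewrite subr_gt0.
have icZ : lambda.-integrable `[a, b] (EFin \o (fun x => 2 * c * h x)).
  apply: continuous_itv_integrable => x.
  by apply: cvgM; [exact: cvg_cst|exact: ch].
have i1 : lambda.-integrable `[a, b] (EFin \o (fun x => h x ^+ 2 - 2 * c * h x)).
  by rewrite (_ : EFin \o _ = (fun x => (h x ^+ 2)%:E - (2 * c * h x)%:E)%E)//;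
    exact: integrableB.
have ic : lambda.-integrable `[a, b] (EFin \o (fun=> c ^+ 2)).
  by apply: continuous_itv_integrable; exact: cst_continuous.
have : 0 <= \int[lambda]_(x in `[a, b]) (h x - c) ^+ 2.
  by apply: Rintegral_ge0 => x _; exact: sqr_ge0.
rewrite (_ : \int[lambda]_(x in `[a, b]) (h x - c) ^+ 2 =
  \int[lambda]_(x in `[a, b]) (h x ^+ 2 - 2 * c * h x + c ^+ 2)); last first.
  by apply: eq_Rintegral => x _; ring.
rewrite RintegralD// RintegralB//.
rewrite RintegralZl// Rintegral_cst//= lebesgue_measure_itv/= lte_fin ab -EFinD/= -/I -/J.
rewrite (_ : J - _ + _ = J - I ^+ 2 / (b - a)).
  by rewrite subr_ge0 ler_pdivrMr// mulrC.
by rewrite /c; field; rewrite gt_eqF.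
Qed.

Lemma continuous_FTC g h a b : a <= b -> continuous h ->
  (forall x, is_derive x 1 g (h x)) ->
  \int[lambda]_(x in `[a, b]) h x = g b - g a.
Proof.
rewrite le_eqVlt => /predU1P[<-|ab] ch gh.
  by rewrite set_itv1 Rintegral_set1 subrr.
have dg x : derivable g x 1 by have := gh x; case.
have cg x : {for x, continuous g}.
  by apply/differentiable_continuous/derivable1_diffP.
rewrite /Rintegral (@continuous_FTC2 _ h g a b)//=.
- exact: continuous_subspaceT.
- split; [by move=> x _|apply: cvg_at_right_filter; exact: cg|
    apply: cvg_at_left_filter; exact: cg].
- by move=> x _; rewrite derive1E; exact: derive_val.
Qed.

(** The increment is the integral of [h] between the two points, so Cauchy-Schwarz bounds its
    square; enlarging that interval to [[a, b]] makes the bound uniform in [s] and [t]. *)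
Lemma sqr_increment_le g h a b s t : continuous h ->
  (forall x, is_derive x 1 g (h x)) -> a <= s <= b -> a <= t <= b ->
  (((g t - g s) ^+ 2)%:E <= (b - a)%:E * energy lambda `[a, b] h)%E.
Proof.
move=> ch gh; wlog st : s t / s <= t.
  move=> H sab tab; have [st|/ltW ts] := leP s t; first exact: H.
  by rewrite -sqrrN opprB; exact: H.
move=> /andP[as_ sb] /andP[at_ tb].
apply: (@le_trans _ _ ((b - a)%:E * energy lambda `[s, t] h)%E).
  rewrite continuous_energy_itv// -EFinM lee_fin -(continuous_FTC st ch gh).
  apply: (le_trans (sqr_Rintegral_le st ch)); rewrite ler_wpM2r//; last lra.
  by apply: Rintegral_ge0 => x _; exact: sqr_ge0.
rewrite lee_wpmul2l//; first by rewrite lee_fin; lra.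
apply: energy_subset => //; first by apply: measurable_funTS; exact: continuous_measurable_fun.
by apply: subset_itv; rewrite bnd_simp.
Qed.

Lemma integral_itv_cst a b (c : R) : a <= b ->
  (\int[lambda]_(x in `[a, b]) c%:E = (c * (b - a))%:E)%E.
Proof.
move=> ab; rewrite integral_cst//= lebesgue_measure_itv/= lte_fin.
move: ab; rewrite le_eqVlt => /predU1P[->|->]; last by rewrite -EFinD -EFinM.
by rewrite ltxx mule0 subrr mulr0.
Qed.

Lemma energy_itv_cst a b (c : R) : a <= b ->
  energy lambda `[a, b] (cst c) = (c ^+ 2 * (b - a))%:E.
Proof. by move=> ab; exact: (integral_itv_cst (c ^+ 2) ab). Qed.

Lemma energy_itv_le g a b (c : R) : continuous g -> a <= b ->
  (forall x, a <= x <= b -> g x ^+ 2 <= c) ->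
  (energy lambda `[a, b] g <= (c * (b - a))%:E)%E.
Proof.
move=> cg ab gc; rewrite -integral_itv_cst//; apply: ge0_le_integral => //.
- by move=> y _; rewrite lee_fin sqr_ge0.
- by apply: measurable_sqr => //; apply: measurable_funTS; exact: continuous_measurable_fun.
Qed.

End line.

(** * Poincaré inequalities on the unit interval *)

Section unit_interval.
Variable R : realType.
Local Notation lambda := (@lebesgue_measure R).
Implicit Types (g h : R -> R) (x y s t : R).

Lemma lebesgue_itv01 : (lambda `[0%R, 1%R] = 1)%E.
Proof. by rewrite lebesgue_measure_itv/= lte_fin ltr01 sube0. Qed.

Lemma energy_itv01_le g (c : R) : continuous g ->
  (forall y, 0 <= y <= 1 -> g y ^+ 2 <= c) -> (energy lambda `[0%R, 1%R] g <= c%:E)%E.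
Proof. by move=> cg /(energy_itv_le cg (@ler01 R)); rewrite subr0 mulr1. Qed.

Lemma sqr_mean_le_energy g : continuous g ->
  (((\int[lambda]_(y in `[0, 1]) g y) ^+ 2)%:E <= energy lambda `[0%R, 1%R] g)%E.
Proof.
move=> cg; rewrite continuous_energy_itv// lee_fin.
by have := sqr_Rintegral_le (@ler01 R) cg; rewrite subr0 mul1r.
Qed.

Lemma sqr_increment01_le g h s t : continuous h ->
  (forall x, is_derive x 1 g (h x)) -> 0 <= s <= 1 -> 0 <= t <= 1 ->
  (g t - g s) ^+ 2 <= \int[lambda]_(y in `[0, 1]) h y ^+ 2.
Proof.
move=> ch gh s01 t01; have := sqr_increment_le ch gh s01 t01.
by rewrite subr0 mul1e continuous_energy_itv.
Qed.

Lemma is_derive_continuous g h : (forall x, is_derive x 1 g (h x)) -> continuous g.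
Proof.
move=> gh x; apply/differentiable_continuous/derivable1_diffP.
by have := gh x; case.
Qed.

(** Each [g y] is the boundary value [g 0] plus an increment whose square is at most the energy of
    [h]. *)
Lemma energy_itv01_le_boundary g h : continuous h ->
  (forall x, is_derive x 1 g (h x)) ->
  (energy lambda `[0%R, 1%R] g <=
   2%:E * ((g 0) ^+ 2)%:E + 2%:E * energy lambda `[0%R, 1%R] h)%E.
Proof.
move=> ch gh; rewrite (continuous_energy_itv _ _ ch) -!EFinM -EFinD.
apply: energy_itv01_le => [|y y01]; first exact: is_derive_continuous gh.
have := @sqr_increment01_le g h 0 y ch gh; rewrite lexx ler01 y01 => /(_ isT isT).
(* For reals p and q, the gap between [2 * p ^+ 2 + 2 * (q - p) ^+ 2] and [q ^+ 2] is exactly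
   [(q - 2 * p) ^+ 2]; the squares handed to [nra] further on arise in the same way. *)
have := sqr_ge0 (g y - 2 * g 0); nra.
Qed.

(** Poincaré-Wirtinger with the mean kept explicit: [g y - m] is the average over [s] of the
    increments [g y - g s], each of square at most [e]. *)
Lemma energy_itv01_le_mean g h : continuous h ->
  (forall x, is_derive x 1 g (h x)) ->
  (energy lambda `[0%R, 1%R] g <=
   2%:E * ((\int[lambda]_(y in `[0, 1]) g y) ^+ 2)%:E +
   2%:E * energy lambda `[0%R, 1%R] h)%E.
Proof.
move=> ch gh; have cg := is_derive_continuous gh.
rewrite (continuous_energy_itv _ _ ch) -!EFinM -EFinD.
apply: energy_itv01_le => // y y01.
set m := \int[_]_(_ in _) g _; set e := \int[_]_(_ in _) _ ^+ 2.
have ccst : continuous (fun _ : R => g y) by move=> ?; exact: cvg_cst.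
have cyg : continuous (fun s => g y - g s).
  by move=> s; apply: cvgB; [exact: ccst|exact: cg].
have mE : \int[lambda]_(s in `[0, 1]) (g y - g s) = g y - m.
  rewrite RintegralB//; [|exact: continuous_itv_integrable..].
  by rewrite Rintegral_cst//= lebesgue_itv01 mulr1.
have : (g y - m) ^+ 2 <= e.
  rewrite -lee_fin -mE; apply: le_trans (sqr_mean_le_energy cyg) _.
  by apply: energy_itv01_le => // s s01; exact: sqr_increment01_le.
have := sqr_ge0 (g y - 2 * m); nra.
Qed.

End unit_interval.

(** * Slices, partial derivatives and supports of test functions *)

Section plane.
Variable R : realType.
Local Notation lambda := (@lebesgue_measure R).
Implicit Types (f g phi psi : R * R -> R) (x y s t : R).

Lemma continuous_vslice f x : continuous f -> continuous (fun y => f (x, y)).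
Proof.
move=> cf y; apply: (@continuous_comp R (R * R)%type R (fun y => (x, y)) f); last exact: cf.
by apply: (@cvg_pair _ _ _ (nbhs (y : R)) (nbhs (x : R)) (nbhs (y : R)));
  [exact: cvg_cst|exact: cvg_id].
Qed.

Lemma continuous_hslice f y : continuous f -> continuous (fun x => f (x, y)).
Proof.
move=> cf x; apply: (@continuous_comp R (R * R)%type R (fun x => (x, y)) f); last exact: cf.
by apply: (@cvg_pair _ _ _ _ (nbhs (x : R)) (nbhs (y : R))); [exact: cvg_id|exact: cvg_cst].
Qed.

Lemma is_derive_vslice phi x t : derivable phi (x, t) (ey R) ->
  is_derive t 1 (fun t => phi (x, t)) ('D_(ey R) phi (x, t)).
Proof.
(* The slice and [phi] in direction [ey] have the same difference quotient, so derivability and the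
   value of the derivative transfer together. *)
have E : (fun h : R => h^-1 *: (phi (x, h *: (1 : R) + t) - phi (x, t))) =
    (fun h => h^-1 *: (phi (h *: ey R + (x, t)) - phi (x, t))).
  apply/funext => h; congr (_ *: (phi _ - _)).
  by apply/pair_equal_spec; split; rewrite /= ?scaler0 ?add0r.
by move=> d; split; rewrite /derivable /derive /= E.
Qed.

Lemma is_derive_hslice phi y t : derivable phi (t, y) (ex R) ->
  is_derive t 1 (fun t => phi (t, y)) ('D_(ex R) phi (t, y)).
Proof.
have E : (fun h : R => h^-1 *: (phi (h *: (1 : R) + t, y) - phi (t, y))) =
    (fun h => h^-1 *: (phi (h *: ex R + (t, y)) - phi (t, y))).
  apply/funext => h; congr (_ *: (phi _ - _)).
  by apply/pair_equal_spec; split; rewrite /= ?scaler0 ?add0r.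
by move=> d; split; rewrite /derivable /derive /= E.
Qed.

Lemma ex_in : ex R \in [:: ex R; ey R]. Proof. by rewrite inE eqxx. Qed.
Lemma ey_in : ey R \in [:: ex R; ey R]. Proof. by rewrite !inE eqxx orbT. Qed.

Lemma smooth_continuous phi : smooth phi -> continuous phi.
Proof. by move=> /(_ [::]) []. Qed.

Lemma smooth_derivable phi e z : smooth phi -> e \in [:: ex R; ey R] ->
  derivable phi z e.
Proof. by move=> /(_ [::]) [//|_] d; exact: d. Qed.

Lemma smooth_partial phi e : smooth phi -> e \in [:: ex R; ey R] ->
  smooth ('D_e phi).
Proof.
(* [foldr] applies the last entry of the list first, so a derivative taken beforehand is appended at
   the end. *)
move=> sphi eE s sE; rewrite (_ : iter_partial s _ = iter_partial (rcons s e) phi).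
  by apply: sphi => e'; rewrite mem_rcons inE => /predU1P[->//|/sE].
by rewrite /iter_partial foldr_rcons.
Qed.

Lemma test_function_partial phi e : test_function setT phi ->
  e \in [:: ex R; ey R] -> test_function setT ('D_e phi).
Proof.
move=> [sphi [K [cK KT phi0]]] eE; split; first exact: smooth_partial.
exists K; split => // z nKz.
(* The same [K] serves for the derivative: its complement is open, so [phi] vanishes near every
   point outside [K]. *)
have oK : open (~` K) by apply: closed_openC; apply: compact_closed => //; exact: norm_hausdorff.
rewrite (_ : 'D_e phi z = 'D_e (cst 0) z); first exact: derive_cst.
apply: near_eq_derive; near=> w; apply: phi0.
by near: w; exact: open_nbhs_nbhs.
Unshelve. all: by end_near. Qed.

Lemma test_function_bounded phi : test_function setT phi ->
  exists C, forall z, `|phi z| <= C.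
Proof.
move=> [sphi [K [cK _ phi0]]].
have : compact (phi @` K).
  by apply: continuous_compact => //; apply/continuous_subspaceT/smooth_continuous.
move=> /compact_bounded[M [Mr MK]].
exists (Num.max 0 (M + 1)) => z; rewrite le_max.
have [/phi0 ->|/contrapT Kz] := pselect (~ K z); first by rewrite normr0 lexx.
by apply/orP; right; apply: (MK (M + 1)); [rewrite ltrDl|exists z].
Qed.

(** The bound [L] is independent of [y], which gives the vertical means of [phi] a bounded
    support. *)
Lemma test_function_support phi : test_function setT phi ->
  exists2 L, 0 < L & forall x y, L < `|x| -> phi (x, y) = 0.
Proof.
move=> [sphi [K [cK _ phi0]]].
have [M [Mr MK]] := compact_bounded cK.
exists (Num.max 1 (M + 1)); first by rewrite lt_max ltr01.
move=> x y; rewrite gt_max => /andP[_ Mx]; apply: phi0 => Kxy.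
have := MK (M + 1); rewrite ltrDl => /(_ ltr01 _ Kxy) /=.
by apply/negP; rewrite -ltNge; apply: (lt_le_trans Mx); rewrite prod_normE le_max lexx.
Qed.

End plane.

(** * Vertical means and iterated integrals on the strip *)

Definition vmean (R : realType) (f : R * R -> R) (x : R) : R :=
  \int[@lebesgue_measure R]_(y in `[0, 1]) f (x, y).

Section strip.
Variable R : realType.
Local Notation lambda := (@lebesgue_measure R).
Local Notation strip_energy := (energy (plane_measure R) (strip R)).
Implicit Types (f g phi psi : R * R -> R) (x y s t : R).

(** Differentiation under the integral sign on the window []x - 1, x + 1[], dominated by a constant:
    the horizontal derivative of [phi] is again a test function, hence bounded. *)
Lemma is_derive_vmean phi x : test_function setT phi ->
  is_derive x 1 (vmean phi) (vmean ('D_(ex R) phi) x).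
Proof.
move=> tphi; have cphi := smooth_continuous tphi.1.
have [C HC] := test_function_bounded (test_function_partial tphi (ex_in R)).
have C0 : 0 <= C by exact: le_trans (HC (0, 0)).
have dphi y t : is_derive t 1 (fun t => phi (t, y)) ('D_(ex R) phi (t, y)).
  by apply: is_derive_hslice; apply: smooth_derivable tphi.1 (ex_in R).
pose F t y := phi (t, y).
have d1 t y : partial1of2 F t y = 'D_(ex R) phi (t, y).
  by rewrite partial1of2E; exact: derive_val.
have Ix : `]x - 1, x + 1[%classic x by rewrite /= in_itv/=; apply/andP; split; lra.
have intF t : `]x - 1, x + 1[%classic t -> lambda.-integrable `[0, 1] (EFin \o F t).
  by move=> _; apply: continuous_itv_integrable; exact: continuous_vslice.
have dF t y : `]x - 1, x + 1[%classic t -> `[0, 1]%classic y -> derivable (F ^~ y) t 1.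
  by move=> _ _; have [] := dphi y t.
have intC : lambda.-integrable `[0, 1] (EFin \o cst C).
  by apply: continuous_itv_integrable => ?; exact: cvg_cst.
have ubC t y : `]x - 1, x + 1[%classic t -> `[0, 1]%classic y -> `|partial1of2 F t y| <= cst C y.
  by move=> _ _; rewrite d1; exact: HC.
split.
  exact: (derivable_under_integral _ Ix intF dF _ intC ubC).
have C1 y : 0 <= cst C y by [].
rewrite -derive1E.
have mI : measurable (`[0, 1]%classic : set (measurableTypeR R)) by exact: measurable_itv.
have E := differentiation_under_integral mI Ix intF dF C1 intC ubC.
apply: (etrans E).
by apply: eq_Rintegral => y _; exact: d1.
Qed.

Lemma continuous_vmean phi : test_function setT phi -> continuous (vmean phi).
Proof. by move=> tphi; apply: is_derive_continuous => x; exact: is_derive_vmean. Qed.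

Lemma measurable_strip :
  measurable (strip R : set (measurableTypeR R * measurableTypeR R)).
Proof.
rewrite (_ : strip R = setT `*` `]0, 1[%classic); first exact: measurableX.
by apply/seteqP; split=> [z|z []]; rewrite /strip /= in_itv/=.
Qed.

Local Notation sqr_strip f :=
  ((fun z => (f z ^+ 2)%:E : \bar R) \_ (strip R)).

Let measurable_sqr_strip f : continuous f ->
  measurable_fun [set: measurableTypeR R * measurableTypeR R] (sqr_strip f).
Proof.
move=> cf; apply/(measurable_restrictT _ measurable_strip).
apply: measurable_funTS; apply: measurable_sqr => //.
exact: continuous_plane_measurable.
Qed.

Let sqr_strip_ge0 f z : (0 <= sqr_strip f z)%E.
Proof. by rewrite patchE; case: ifPn => // _; rewrite lee_fin sqr_ge0. Qed.

Let fubini_F_sqr_strip f x : continuous f ->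
  fubini_F lambda (sqr_strip f) x = energy lambda `[0, 1] (fun y => f (x, y)).
Proof.
(* Sections of the strip are open intervals while energies are taken on [[0, 1]]; the two endpoints
   are negligible. *)
move=> cf; rewrite /fubini_F /energy integral_itv_bndoo; last first.
  apply: measurable_sqr => //; apply: measurable_funTS.
  by apply: continuous_measurable_fun; exact: continuous_vslice.
rewrite [RHS]integral_mkcond; apply: eq_integral => y _.
by rewrite !patchE; congr (if _ then _ else _).
Qed.

Lemma measurable_energy_slice f : continuous f ->
  measurable_fun setT (fun x => energy lambda `[0, 1] (fun y => f (x, y))).
Proof.
move=> cf; under eq_fun do rewrite -fubini_F_sqr_strip//.
apply: measurable_fun_fubini_tonelli_F; [exact: measurable_sqr_strip|].
by move=> z; exact: sqr_strip_ge0.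
Qed.

Lemma strip_energy_iterated f : continuous f ->
  strip_energy f =
  (\int[lambda]_x energy lambda `[0%R, 1%R] (fun y => f (x, y)))%E.
Proof.
move=> cf; have fubini :=
  @fubini_tonelli1 _ _ _ _ R lambda lambda _ (measurable_sqr_strip cf) (sqr_strip_ge0 f).
rewrite /energy [LHS]integral_mkcond; apply: (etrans fubini).
by apply: eq_integral => x _; exact: fubini_F_sqr_strip.
Qed.

(** Lifts an estimate on vertical segments to the strip by Tonelli; [h] will be a boundary value or
    a vertical mean. *)
Lemma strip_energy_le f g (h : R -> R) (a b : R) : continuous f -> continuous g ->
  measurable_fun setT h -> 0 <= a -> 0 <= b ->
  (forall x, energy lambda `[0%R, 1%R] (fun y => f (x, y)) <=
    a%:E * (h x ^+ 2)%:E + b%:E * energy lambda `[0%R, 1%R] (fun y => g (x, y)))%E ->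
  (strip_energy f <= a%:E * energy lambda setT h + b%:E * strip_energy g)%E.
Proof.
move=> cf cg mh a0 b0 fhg; rewrite !strip_energy_iterated//.
have mh2 := measurable_sqr mh.
have mg := measurable_energy_slice cg.
have h0 x : (0 <= (h x ^+ 2)%:E)%E by rewrite lee_fin sqr_ge0.
have g0 x := energy_ge0 lambda `[0, 1] (fun y => g (x, y)).
have -> : (a%:E * energy lambda setT h = \int[lambda]_x (a%:E * (h x ^+ 2)%:E))%E.
  by rewrite ge0_integralZl_EFin.
rewrite -(@ge0_integralZl_EFin _ _ _ lambda _ _ _ (fun x _ => g0 x) mg)//.
rewrite -ge0_integralD//.
- apply: ge0_le_integral => //.
  + by move=> x _; exact: energy_ge0.
  + exact: measurable_energy_slice.
  + by apply: emeasurable_funD; apply: measurable_funeM.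
- by move=> x _; rewrite mule_ge0.
- exact: measurable_funeM.
- by move=> x _; rewrite mule_ge0.
- exact: measurable_funeM.
Qed.

Lemma energy_vmean_le f : continuous f -> measurable_fun setT (vmean f) ->
  (energy lambda setT (vmean f) <= strip_energy f)%E.
Proof.
move=> cf mf; rewrite strip_energy_iterated//; apply: ge0_le_integral => //.
- by move=> x _; rewrite lee_fin sqr_ge0.
- exact: measurable_sqr.
- exact: measurable_energy_slice.
- by move=> x _; apply: sqr_mean_le_energy; exact: continuous_vslice.
Qed.

Lemma strip_energy_le_boundary psi : smooth psi ->
  (strip_energy psi <= 2%:E * energy lambda setT (fun x => psi (x, 0%R)) +
    2%:E * strip_energy ('D_(ey R) psi))%E.
Proof.
move=> spsi; have cpsi := smooth_continuous spsi.
have cD := smooth_continuous (smooth_partial spsi (ey_in R)).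
apply: strip_energy_le => //.
- by apply: continuous_measurable_fun; exact: continuous_hslice.
- move=> x; apply: (@energy_itv01_le_boundary _ (fun y => psi (x, y))
      (fun y => 'D_(ey R) psi (x, y))).
    exact: (@continuous_vslice _ ('D_(ey R) psi)).
  by move=> y; apply: is_derive_vslice; apply: smooth_derivable spsi (ey_in R).
Qed.

Lemma strip_energy_le_vmean phi : test_function setT phi ->
  (strip_energy phi <= 2%:E * energy lambda setT (vmean phi) +
    2%:E * strip_energy ('D_(ey R) phi))%E.
Proof.
move=> tphi; have cphi := smooth_continuous tphi.1.
have cD := smooth_continuous (smooth_partial tphi.1 (ey_in R)).
apply: strip_energy_le => //.
- by apply: continuous_measurable_fun; exact: continuous_vmean.
- move=> x; apply: (@energy_itv01_le_mean _ (fun y => phi (x, y))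
      (fun y => 'D_(ey R) phi (x, y))).
    exact: (@continuous_vslice _ ('D_(ey R) phi)).
  by move=> y; apply: is_derive_vslice; apply: smooth_derivable tphi.1 (ey_in R).
Qed.

End strip.

(** * Extended real sequences tending to 0 *)

Section vanishing.
Variable R : realType.
Implicit Types (a b c : nat -> \bar R).

Lemma cvge0_le a (e : R) : a k @[k --> \oo] --> 0%E -> 0 < e ->
  \forall k \near \oo, (a k <= e%:E)%E.
Proof.
move=> /fine_cvgP[fin a0] e0.
have := @cvgr_lt _ _ _ _ _ _ a0 e e0.
move=> lt; near=> k.
have fink : a k \is a fin_num by near: k.
rewrite -(fineK fink) lee_fin ltW//; near: k; exact: lt.
Unshelve. all: by end_near. Qed.

Lemma le_cvge0 a : (forall k, (0 <= a k)%E) ->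
  (forall e, 0 < e -> \forall k \near \oo, (a k <= e%:E)%E) ->
  a k @[k --> \oo] --> 0%E.
Proof.
move=> a0 ae.
have fin k e : (a k <= e%:E)%E -> a k \is a fin_num.
  by move=> ake; rewrite ge0_fin_numE// (le_lt_trans ake)// ltry.
apply/fine_cvgP; split.
  (* The bound for [e = 1] already makes the terms eventually finite. *)
  by apply: filterS (ae 1 ltr01) => k; exact: fin.
apply/cvgr0Pnorm_le => e e0; apply: filterS (ae e e0) => k ake.
rewrite /= ger0_norm ?fine_ge0// -lee_fin fineK//; exact: fin ake.
Qed.

Lemma lee_comb (x y z : \bar R) (s t y' z' : R) : 0 <= s -> 0 <= t ->
  (x <= s%:E * y + t%:E * z)%E -> (y <= y'%:E)%E -> (z <= z'%:E)%E ->
  (x <= (s * y' + t * z')%:E)%E.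
Proof.
move=> s0 t0 xyz yy zz; apply: (le_trans xyz); rewrite EFinD !EFinM.
by apply: leeD; apply: lee_wpmul2l => //; rewrite lee_fin.
Qed.

Lemma cvge0_comb a b c (s t : R) : 0 <= s -> 0 <= t -> (forall k, (0 <= a k)%E) ->
  (forall k, (a k <= s%:E * b k + t%:E * c k)%E) ->
  b k @[k --> \oo] --> 0%E -> c k @[k --> \oo] --> 0%E ->
  a k @[k --> \oo] --> 0%E.
Proof.
move=> s0 t0 a0 abc b0 c0; apply: le_cvge0 => // e e0.
(* The added 1 keeps the divisor positive when [s] and [t] both vanish. *)
have D0 : 0 < s + t + 1 by lra.
have [d [d0 dE]] : exists d, 0 < d /\ d * (s + t + 1) = e.
  by exists (e / (s + t + 1)); rewrite divr_gt0// divfK// gt_eqF.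
near=> k.
have bd : (b k <= d%:E)%E by near: k; exact: cvge0_le.
have cd : (c k <= d%:E)%E by near: k; exact: cvge0_le.
by apply: (le_trans (lee_comb s0 t0 (abc k) bd cd)); rewrite lee_fin; lra.
Unshelve. all: by end_near. Qed.

End vanishing.

(** * Functions on the line with vanishing derivative in the limit *)

Section line_vanishing.
Variable R : realType.
Local Notation lambda := (@lebesgue_measure R).
Implicit Types (M r : R -> R).

(* Average [M x ^+ 2 <= 2 * M s ^+ 2 + 2 * (M x - M s) ^+ 2] over [s] in
   [[x, x + T]]. *)
Lemma sqr_le_energy M r (B rho T x : R) : continuous r ->
  (forall s : R, is_derive s 1 M (r s)) -> 0 < T ->
  (energy lambda setT M <= B%:E)%E -> (energy lambda setT r <= rho%:E)%E ->
  T * M x ^+ 2 <= 2 * B + 2 * T ^+ 2 * rho.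
Proof.
move=> cr Mr T0 MB rrho.
have cM := is_derive_continuous Mr.
have mM : measurable_fun setT M by exact: continuous_measurable_fun.
have mr : measurable_fun setT r by exact: continuous_measurable_fun.
have rho0 : 0 <= rho by rewrite -lee_fin; apply: le_trans rrho; exact: energy_ge0.
pose I := `[x, x + T]%classic : set (measurableTypeR R).
have mI : measurable I by exact: measurable_itv.
have MI : (energy lambda I M <= B%:E)%E.
  by apply: le_trans MB; exact: energy_subset.
have rI : (energy lambda I r <= rho%:E)%E.
  by apply: le_trans rrho; exact: energy_subset.
have incr s : x <= s <= x + T -> (M x - M s) ^+ 2 <= T * rho.
  move=> sI; rewrite -lee_fin.
  have xI : x <= x <= x + T by rewrite lexx/=; lra.
  apply: (le_trans (sqr_increment_le cr Mr sI xI)).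
  rewrite (_ : x + T - x = T); last by ring.
  by rewrite EFinM lee_wpmul2l// lee_fin ltW.
have mcst d : measurable_fun I (cst d : R -> R) by exact: measurable_cst.
have Trho : 0 <= 2 * (T * rho) by rewrite mulr_ge0// mulr_ge0// ltW.
have xT : x <= x + T by lra.
have xTT : x + T - x = T by ring.
have MI2 : measurable_fun I M by exact: measurable_funTS.
(* The energy of [cst (M x)] over [I] is [T * M x ^+ 2]; [cst 1] carries the increment bound and
   contributes one more factor [T]. *)
have le : (energy lambda I (cst (M x)) <=
    2%:E * energy lambda I M + (2 * (T * rho))%:E * energy lambda I (cst 1%R))%E.
  apply: energy_le2 => //; apply: aeW => s; rewrite /I/= in_itv/= => /incr.
  have := sqr_ge0 (M x - 2 * M s); nra.
have c1 : (energy lambda I (cst 1%R) <= T%:E)%E.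
  by rewrite energy_itv_cst// expr1n mul1r xTT.
have := lee_comb (ler0n R 2) Trho le MI c1.
by rewrite energy_itv_cst// xTT lee_fin; nra.
Qed.

Lemma energy_restrict (A : set (measurableTypeR R)) M :
  energy lambda setT (M \_ A) = energy lambda A M.
Proof.
rewrite [RHS]integral_mkcond; apply: eq_integral => x _; rewrite !patchE.
by case: ifPn => // _; rewrite expr0n.
Qed.

(* Outside the bounded support of [M N] the Cauchy property controls [M k];
   on it, [sqr_le_energy] with [T] large does. *)
Lemma energy_line_cvg0 (M r : nat -> R -> R) (B : R) :
  (forall k, continuous (r k)) -> (forall k (s : R), is_derive s 1 (M k) (r k s)) ->
  (forall k, exists2 L, 0 < L & forall x, L < `|x| -> M k x = 0) ->
  (forall e : R, 0 < e -> exists N, forall k, (N <= k)%N ->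
    (energy lambda setT (fun x => (M k x - M N x)%R) <= e%:E)%E) ->
  (\forall k \near \oo, (energy lambda setT (M k) <= B%:E)%E) ->
  energy lambda setT (r k) @[k --> \oo] --> 0%E ->
  energy lambda setT (M k) @[k --> \oo] --> 0%E.
Proof.
move=> cr Mr suppM cauchyM boundM r0.
have cM k := is_derive_continuous (Mr k).
have mM k : measurable_fun setT (M k) by exact: continuous_measurable_fun.
apply: le_cvge0 => [k|e e0]; first exact: energy_ge0.
have e3 : 0 < e / 3 by lra.
have [N MN] := cauchyM _ e3.
have [L L0 suppL] := suppM N.
(* On [[- L, L]], [sqr_le_energy] gives at most [4 * L * B' / T + 4 * L * T * rho]. First [T], then
   [rho] is chosen to make each term [e / 3]; the last third is the Cauchy bound. The maximum with 1
   ensures [0 < T]. *)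
pose B' := Num.max B 1.
have B'0 : 0 < B' by rewrite lt_max ltr01 orbT.
have [T [T0 TE]] : exists T, 0 < T /\ T * (e / 3) = 4 * L * B'.
  exists (4 * L * B' / (e / 3)); rewrite divfK ?gt_eqF//; split => //.
  by rewrite divr_gt0// !mulr_gt0.
have [rho [rho0 rhoE]] : exists rho, 0 < rho /\ 4 * L * T * rho = e / 3.
  have LT : 0 < 4 * L * T by rewrite !mulr_gt0.
  exists (e / 3 / (4 * L * T)); split; first exact: divr_gt0.
  by rewrite mulrC divfK// gt_eqF.
pose A := `[- L, L]%classic : set (measurableTypeR R).
have mA : measurable A by exact: measurable_itv.
near=> k.
have kN : (N <= k)%N by near: k; exact: nbhs_infty_ge.
have MkB : (energy lambda setT (M k) <= B'%:E)%E.
  apply: (@le_trans _ _ B%:E); last by rewrite lee_fin le_max lexx.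
  by near: k.
have rk : (energy lambda setT (r k) <= rho%:E)%E by near: k; exact: cvge0_le.
have MA : (energy lambda A (M k) <= (2 * e / 3)%:E)%E.
  have sqrM x : M k x ^+ 2 <= (2 * B' + 2 * T ^+ 2 * rho) / T.
    by rewrite ler_pdivlMr// mulrC; exact: sqr_le_energy (Mr k) _ MkB rk.
  apply: le_trans (energy_itv_le (cM k) _ (fun x _ => sqrM x)) _.
    by lra.
  rewrite lee_fin mulrAC ler_pdivrMr//; nra.
have mMA : measurable_fun setT (M k \_ A).
  by apply/(measurable_restrictT _ mA); apply: measurable_funTS; exact: mM.
have mMN : measurable_fun setT (fun x => M k x - M N x) by exact: measurable_funB.
(* Outside [A] the function [M N] is zero, so there [M k] coincides with [M k - M N]. *)
have le : (energy lambda setT (M k) <= 1%:E * energy lambda setT (M k \_ A) +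
    1%:E * energy lambda setT (fun x => (M k x - M N x)%R))%E.
  apply: (@energy_le2 _ _ _ lambda _ measurableT _ _ _ _ _ (mM k)
    mMA mMN ler01 ler01).
  apply: aeW => x _; rewrite !mul1r patchE.
  case: ifPn => [_|]; first by rewrite lerDl sqr_ge0.
  rewrite notin_setE => Ax; have /suppL -> : L < `|x|.
    by rewrite ltNge; apply/negP; rewrite ler_norml => xL; apply: Ax; rewrite /A/= in_itv.
  by rewrite subr0 expr0n add0r.
apply: (le_trans (lee_comb ler01 ler01 le _ (MN k kN))).
  by rewrite energy_restrict; exact: MA.
by rewrite lee_fin; lra.
Unshelve. all: by end_near. Qed.

End line_vanishing.

(** * Passage to the limit along the approximating test functions *)

Section strip_limits.
Variable R : realType.
Local Notation lambda := (@lebesgue_measure R).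
Local Notation strip_energy := (energy (plane_measure R) (strip R)).
Local Notation plane := (measurableTypeR R * measurableTypeR R)%type.
Implicit Types (u w f g : R * R -> R).

Let mstrip := @measurable_strip R.

Lemma strip_energy_le_subl f g : measurable_fun (strip R : set plane) f ->
  measurable_fun (strip R : set plane) g ->
  (strip_energy f <= 2%:E * strip_energy g + 2%:E * strip_energy (g \- f)%R)%E.
Proof.
move=> mf mg.
apply: (@energy_le2 _ _ _ (plane_measure R) _ mstrip _ _ _ _ _
  mf mg (measurable_funB mg mf) (ler0n R 2) (ler0n R 2)).
by apply: aeW => z _ /=; have := sqr_ge0 (f z - 2 * g z); nra.
Qed.

Lemma strip_energy_le_subr f g : measurable_fun (strip R : set plane) f ->
  measurable_fun (strip R : set plane) g ->
  (strip_energy g <= 2%:E * strip_energy f + 2%:E * strip_energy (g \- f)%R)%E.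
Proof.
move=> mf mg.
apply: (@energy_le2 _ _ _ (plane_measure R) _ mstrip _ _ _ _ _
  mg mf (measurable_funB mg mf) (ler0n R 2) (ler0n R 2)).
by apply: aeW => z _ /=; have := sqr_ge0 (g z - 2 * f z); nra.
Qed.

Lemma smooth_strip_measurable f : smooth f ->
  measurable_fun (strip R : set plane) f.
Proof.
by move=> /smooth_continuous cf; apply: measurable_funTS;
  exact: continuous_plane_measurable.
Qed.

(** Three comparisons each cost a factor 2: from [u] to [phi k], from [phi k] to its vertical
    derivative, from that to [w]. Hence the 8. The sequence [m] stands for the energy of boundary
    values or of vertical means. *)
Lemma strip_energy_limit (phi : nat -> R * R -> R) (m : nat -> \bar R) u w :
  (forall k, smooth (phi k)) -> in_strip_L2 u -> in_strip_L2 w ->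
  strip_L2norm (phi k \- u) @[k --> \oo] --> 0%E ->
  strip_L2norm ('D_(ey R) (phi k) \- w) @[k --> \oo] --> 0%E ->
  m k @[k --> \oo] --> 0%E ->
  (forall k, strip_energy (phi k) <=
    2%:E * m k + 2%:E * strip_energy ('D_(ey R) (phi k)))%E ->
  (strip_energy u <= 8%:E * strip_energy w)%E.
Proof.
move=> sphi [mu _] [mw wL2] /energy_cvg0 phiu /energy_cvg0 Dphiw m0 phim.
have wfin : strip_energy w \is a fin_num.
  rewrite ge0_fin_numE; last exact: energy_ge0.
  exact: energy_lt_pinfty wL2.
apply/lee_addgt0Pr => e e0.
(* With all three errors at most d, the chained bounds add up to
   [2 * (2 * d + 2 * (2 * d)) + 2 * d], that is 14 d. *)
have d0 : 0 < e / 14 by lra.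
have [k [uk wk mk]] : exists k, [/\ (strip_energy (phi k \- u)%R <= (e / 14)%:E)%E,
    (strip_energy ('D_(ey R) (phi k) \- w)%R <= (e / 14)%:E)%E &
    (m k <= (e / 14)%:E)%E].
  have [N _ H] := filterI (cvge0_le phiu d0)
    (filterI (cvge0_le Dphiw d0) (cvge0_le m0 d0)).
  by exists N; have [? [? ?]] := H N (leqnn N).
have ge2 : 0 <= 2 :> R by [].
have mphi := smooth_strip_measurable (sphi k).
have mD := smooth_strip_measurable (smooth_partial (sphi k) (ey_in R)).
move: wfin => /fineK; set q := fine _ => qE.
have le1 := lee_comb ge2 ge2 (strip_energy_le_subr mw mD) (_ : strip_energy w <= q%:E)%E wk.
have le2 := lee_comb ge2 ge2 (phim k) mk (le1 _).
have le3 := lee_comb ge2 ge2 (strip_energy_le_subl mu mphi) (le2 _) uk.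
rewrite -qE; apply: (le_trans (le3 _)); first by rewrite qE.
by rewrite -EFinM -EFinD lee_fin; lra.
Qed.

Lemma boundary_energy_cvg0 (psi : nat -> R * R -> R) (g : R * R -> R) (b : R) :
  (forall k, smooth (psi k)) -> in_L2 lambda setT (fun x => g (x, b)) ->
  {ae lambda, forall x, g (x, b) = 0} ->
  L2norm lambda setT (fun x => psi k (x, b) - g (x, b)) @[k --> \oo] --> 0%E ->
  energy lambda setT (fun x => psi k (x, b)) @[k --> \oo] --> 0%E.
Proof.
move=> spsi [mg _] g0 /energy_cvg0 psig.
have mpsi k : measurable_fun [set: measurableTypeR R] (fun x => psi k (x, b)).
  by apply: continuous_measurable_fun; apply: continuous_hslice; exact: smooth_continuous.
apply: (@cvge0_comb _ _ _ _ 1 0 _ _ _ _ psig psig) => // k; first exact: energy_ge0.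
apply: (@energy_le2 _ _ _ lambda _ measurableT _ _ _ _ _ (mpsi k)
  (measurable_funB (mpsi k) mg) (measurable_funB (mpsi k) mg)) => //.
move: g0; apply: (@filterS _ _ (ae_filter_ringOfSetsType lambda)) => x /= -> _.
by rewrite subr0; lra.
Qed.

Lemma vmeanB f g x : continuous f -> continuous g ->
  vmean (fun z => f z - g z) x = vmean f x - vmean g x.
Proof.
by move=> cf cg; rewrite /vmean RintegralB//;
  apply: continuous_itv_integrable; exact: continuous_vslice.
Qed.

Lemma vmeanD f g x : continuous f -> continuous g ->
  vmean (f \+ g) x = vmean f x + vmean g x.
Proof.
by move=> cf cg; rewrite /vmean RintegralD//;
  apply: continuous_itv_integrable; exact: continuous_vslice.
Qed.

Lemma vmean_partial_ey psi x : smooth psi ->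
  vmean ('D_(ey R) psi) x = psi (x, 1) - psi (x, 0).
Proof.
move=> spsi; apply: (@continuous_FTC _ (fun y => psi (x, y))) => //.
  apply: (@continuous_vslice _ ('D_(ey R) psi)).
  exact: smooth_continuous (smooth_partial spsi (ey_in R)).
by move=> y; apply: is_derive_vslice; exact: smooth_derivable spsi (ey_in R).
Qed.

(** Mass balance on vertical segments: the means of the first component vary only through the mean
    divergence and the flux across the two boundary lines, which both tend to 0. [energy_line_cvg0]
    turns this into decay of the means themselves. *)
Lemma vmean_energy_cvg0 (phi psi : nat -> R * R -> R) u w1 w2 :
  (forall k, test_function setT (phi k)) -> (forall k, test_function setT (psi k)) ->
  in_strip_L2 u -> in_strip_L2 w1 -> in_strip_L2 w2 ->
  {ae plane_measure R, forall z, strip R z -> w1 z + w2 z = 0} ->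
  strip_L2norm (phi k \- u) @[k --> \oo] --> 0%E ->
  strip_L2norm ('D_(ex R) (phi k) \- w1) @[k --> \oo] --> 0%E ->
  strip_L2norm ('D_(ey R) (psi k) \- w2) @[k --> \oo] --> 0%E ->
  energy lambda setT (fun x => psi k (x, 0)) @[k --> \oo] --> 0%E ->
  energy lambda setT (fun x => psi k (x, 1)) @[k --> \oo] --> 0%E ->
  energy lambda setT (vmean (phi k)) @[k --> \oo] --> 0%E.
Proof.
move=> tphi tpsi [mu uL2] [mw1 _] [mw2 _] div0 /energy_cvg0 phiu
  /energy_cvg0 Dphi /energy_cvg0 Dpsi psi0 psi1.
have sphi k := (tphi k).1; have spsi k := (tpsi k).1.
have tDphi k := test_function_partial (tphi k) (ex_in R).
have tDpsi k := test_function_partial (tpsi k) (ey_in R).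
have sDphi k := (tDphi k).1; have sDpsi k := (tDpsi k).1.
have cphi k := smooth_continuous (sphi k).
have cpsi k := smooth_continuous (spsi k).
have cDphi k := smooth_continuous (sDphi k).
have cDpsi k := smooth_continuous (sDpsi k).
have mphi k := smooth_strip_measurable (sphi k).
have mDphi k := smooth_strip_measurable (sDphi k).
have mDpsi k := smooth_strip_measurable (sDpsi k).
have ge2 : 0 <= 2 :> R by [].
pose dv k := 'D_(ex R) (phi k) \+ 'D_(ey R) (psi k).
(* As [w1 + w2] vanishes almost everywhere on the strip, [dv k] is there the sum of the two
   approximation errors of the derivatives. *)
have dv0 : strip_energy (dv k) @[k --> \oo] --> 0%E.
  apply: (cvge0_comb ge2 ge2 _ _ Dphi Dpsi) => k; first exact: energy_ge0.
  apply: (@energy_le2 _ _ _ (plane_measure R) _ mstrip _ _ _ _ _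
    (measurable_funD (mDphi k) (mDpsi k)) (measurable_funB (mDphi k) mw1)
    (measurable_funB (mDpsi k) mw2) ge2 ge2).
  move: div0; apply: (@filterS _ _ (ae_filter_ringOfSetsType (plane_measure R))).
  move=> z dz /dz {}dz /=.
  have -> : w2 z = - w1 z by lra.
  set a := 'D_ _ _ _; set b := 'D_ _ _ _.
  by have := sqr_ge0 (a - b - 2 * w1 z); nra.
have cdv k : continuous (dv k) by move=> z; apply: cvgD; [exact: cDphi|exact: cDpsi].
have vdv k x : vmean (dv k) x =
    vmean ('D_(ex R) (phi k)) x + vmean ('D_(ey R) (psi k)) x by exact: vmeanD.
have mvdv k : measurable_fun [set: measurableTypeR R] (vmean (dv k)).
  rewrite (funext (vdv k)).
  by apply: measurable_funD; apply: continuous_measurable_fun; exact: continuous_vmean.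
have vdv0 : energy lambda setT (vmean (dv k)) @[k --> \oo] --> 0%E.
  apply: (@cvge0_comb _ _ _ _ 1 0 _ _ _ _ dv0 dv0) => // k; first exact: energy_ge0.
  by rewrite mul1e mul0e adde0; exact (energy_vmean_le (cdv k) (mvdv k)).
have mb b k : measurable_fun [set: measurableTypeR R] (fun x => psi k (x, b)).
  by apply: continuous_measurable_fun; exact: continuous_hslice.
pose jump k x := psi k (x, 1) - psi k (x, 0).
have jump0 : energy lambda setT (jump k) @[k --> \oo] --> 0%E.
  apply: (cvge0_comb ge2 ge2 _ _ psi0 psi1) => k; first exact: energy_ge0.
  apply: (@energy_le2 _ _ _ lambda _ measurableT _ _ _ _ _
    (measurable_funB (mb 1 k) (mb 0 k)) (mb 0 k) (mb 1 k) ge2 ge2).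
  apply: aeW => x _; rewrite /jump /=; have := sqr_ge0 (psi k (x, 1) + psi k (x, 0)); nra.
(* The mean of the vertical derivative of [psi k] is [jump k], so the function here is
   [vmean (dv k)] minus [jump k]. *)
have r0 : energy lambda setT (vmean ('D_(ex R) (phi k))) @[k --> \oo] --> 0%E.
  apply: (cvge0_comb ge2 ge2 _ _ vdv0 jump0) => k; first exact: energy_ge0.
  apply: (@energy_le2 _ _ _ lambda _ measurableT _ _ _ _ _ _
    (mvdv k) (measurable_funB (mb 1 k) (mb 0 k)) ge2 ge2).
    by apply: continuous_measurable_fun; exact: continuous_vmean.
  apply: aeW => x _; rewrite vdv vmean_partial_ey//.
  rewrite /=; set a := vmean _ _; set b := psi k (x, 1) - psi k (x, 0).
  have := sqr_ge0 (a + 2 * b); nra.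
(* Taking vertical means is linear and does not increase the energy, so the means inherit the Cauchy
   property of [phi]. *)
have vB j k : (energy lambda setT (fun x => (vmean (phi k) x - vmean (phi j) x)%R) <=
    strip_energy (fun z => (phi k z - phi j z)%R))%E.
  have cB : continuous (fun z => phi k z - phi j z).
    by move=> z; apply: cvgB; exact: cphi.
  have mB : measurable_fun [set: measurableTypeR R]
      (fun x => vmean (phi k) x - vmean (phi j) x).
    by apply: measurable_funB; apply: continuous_measurable_fun; exact: continuous_vmean.
  have E : (fun x => vmean (phi k) x - vmean (phi j) x) =
      vmean (fun z => phi k z - phi j z) by apply/funext => x; rewrite vmeanB.
  by move: mB; rewrite E; exact: energy_vmean_le.
have [B uB] : exists B, (strip_energy u <= B%:E)%E.
  exists (fine (strip_energy u)); rewrite fineK// ge0_fin_numE; last exact: energy_ge0.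
  exact: energy_lt_pinfty uL2.
(* The bound [2 * B + 2 * 1] holds as soon as the energy of [phi k - u] is at most 1. *)
apply: (@energy_line_cvg0 _ _ (fun k => vmean ('D_(ex R) (phi k))) (2 * B + 2 * 1)) => //.
- by move=> k; exact: continuous_vmean.
- by move=> k s; exact: is_derive_vmean.
- move=> k; have [L L0 HL] := test_function_support (tphi k).
  exists L => // x Lx; rewrite /vmean.
  by under eq_Rintegral do rewrite HL//; rewrite Rintegral_cst// mul0r.
- move=> e e0; have e4 : 0 < e / 4 by lra.
  have [N _ HN] := cvge0_le phiu e4; exists N => k Nk.
  apply: (le_trans (vB N k)).
  apply: (@le_trans _ _ (2 * (e / 4) + 2 * (e / 4))%:E); last by rewrite lee_fin; lra.
  have := HN _ (leqnn N); have := HN _ Nk; apply: lee_comb => //.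
  apply: (@energy_le2 _ _ _ (plane_measure R) _ mstrip _ _ _ _ _
    (measurable_funB (mphi k) (mphi N)) (measurable_funB (mphi k) mu)
    (measurable_funB (mphi N) mu) ge2 ge2).
  apply: aeW => z _ /=; have := sqr_ge0 (phi k z - u z + (phi N z - u z)); nra.
- apply: filterS (cvge0_le phiu ltr01) => k phiuk.
  apply: le_trans (energy_vmean_le (cphi k) _) _.
    by apply: continuous_measurable_fun; exact: continuous_vmean.
  exact: lee_comb (strip_energy_le_subr mu (mphi k)) uB phiuk.
Qed.

(** [xget] falls back on its default only if there is no candidate, and [H1] provides one. *)
Lemma in_strip_L2_weak_partial e u : H1 u -> e \in [:: ex R; ey R] ->
  in_strip_L2 (weak_partial e u).
Proof. by move=> [_ Hu] /Hu[w wP]; rewrite /weak_partial; case: xgetP => [v _ []|/(_ w)/(_ wP)]. Qed.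

Lemma strip_energy_vec f g : measurable_fun (strip R : set plane) f ->
  measurable_fun (strip R : set plane) g ->
  strip_energy (fun z => Num.sqrt (f z ^+ 2 + g z ^+ 2)) =
  (strip_energy f + strip_energy g)%E.
Proof.
move=> mf mg; rewrite /energy -ge0_integralD//.
- by apply: eq_integral => z _; rewrite sqr_sqrtr ?EFinD// addr_ge0// sqr_ge0.
- by move=> z _; rewrite lee_fin sqr_ge0.
- exact: measurable_sqr.
- by move=> z _; rewrite lee_fin sqr_ge0.
- exact: measurable_sqr.
Qed.

End strip_limits.

(** * Combination of the two components *)

Lemma lee_sqrt_add (R : realType) (s : R) (a b c d : \bar R) : 0 <= s ->
  (0 <= a)%E -> (0 <= b)%E -> (0 <= c)%E -> (0 <= d)%E ->
  (a <= s%:E * c)%E -> (b <= s%:E * d)%E ->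
  ((a + b) `^ 2^-1 <= (Num.sqrt s)%:E * (c + d) `^ 2^-1)%E.
Proof.
move=> s0 a0 b0 c0 d0 ac bd.
rewrite -powR12_sqrt// -poweR_EFin -poweRM ?adde_ge0//.
apply: gt0_ler_poweR => //.
- by rewrite in_itv/= leey adde_ge0.
- by rewrite in_itv/= leey mule_ge0// adde_ge0.
- by rewrite ge0_muleDr//; exact: leeD.
Qed.

Theorem corollary3p4 (R : realType) :
  exists C : R, 0 < C /\
    forall u : R * R -> R * R, in_V u ->
      (strip_L2norm_vec u <= C%:E * strip_L2norm_vec (weak_partial_vec (ey R) u))%E.
Proof.
(* Both components satisfy the squared inequality with the factor 8 of [strip_energy_limit]. *)
exists (Num.sqrt 8); split; first by rewrite sqrtr_gt0.
move=> u [[H1u1 H1u2] div0 [g1 [g2 [tr1 tr2 normal0]]]].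
have [_ [phi [tphi phiu Dphi _]]] := tr1.
have [g2L2 [psi [tpsi psiu Dpsi psig2]]] := tr2.
have [exE eyE] := (ex_in R, ey_in R).
(* The outer normal is [(0, -1)] or [(0, 1)], so the normal trace is the trace of the second
   component up to sign. *)
have g2_0 b : b \in [:: 0; 1] -> {ae @lebesgue_measure R, forall x, g2 (x, b) = 0}.
  move=> /normal0; apply: (@filterS _ _ (ae_filter_ringOfSetsType lebesgue_measure)) => x.
  rewrite /= mulr0 add0r.
  by case: ifP => _; rewrite ?mulrN ?mulr1 => // /eqP; rewrite oppr_eq0 => /eqP.
have psi_b b : b \in [:: 0; 1] ->
    energy (@lebesgue_measure R) setT (fun x => psi k (x, b)) @[k --> \oo] --> 0%E.
  move=> bE; apply: (boundary_energy_cvg0 _ (g2L2 b bE) (g2_0 b bE) (psig2 b bE)) => k.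
  by have [] := tpsi k.
have psi0 : energy (@lebesgue_measure R) setT (fun x => psi k (x, 0)) @[k --> \oo] --> 0%E.
  by apply: psi_b; rewrite inE eqxx.
have psi1 : energy (@lebesgue_measure R) setT (fun x => psi k (x, 1)) @[k --> \oo] --> 0%E.
  by apply: psi_b; rewrite !inE eqxx orbT.
have w1x := in_strip_L2_weak_partial H1u1 exE.
have w1y := in_strip_L2_weak_partial H1u1 eyE.
have w2y := in_strip_L2_weak_partial H1u2 eyE.
have [u1 u2] := (H1u1.1, H1u2.1).
(* The vanishing sequence is the energy of the vertical means for the first component, and that of
   the values on the line y = 0 for the second. *)
have le1 := strip_energy_limit (fun k => (tphi k).1) u1 w1y phiu (Dphi _ eyE)
  (vmean_energy_cvg0 tphi tpsi u1 w1x w2y div0 phiu (Dphi _ exE) (Dpsi _ eyE) psi0 psi1)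
  (fun k => strip_energy_le_vmean (tphi k)).
have le2 := strip_energy_limit (fun k => (tpsi k).1) u2 w2y psiu (Dpsi _ eyE) psi0
  (fun k => strip_energy_le_boundary (tpsi k).1).
rewrite /strip_L2norm_vec /strip_L2norm !L2norm_energy.
rewrite (strip_energy_vec u1.1 u2.1) (strip_energy_vec w1y.1 w2y.1).
exact: lee_sqrt_add (ler0n R 8) (energy_ge0 _ _ _) (energy_ge0 _ _ _) (energy_ge0 _ _ _)
  (energy_ge0 _ _ _) le1 le2.
Qed.
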